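(* (a) There exist constants $c>0$ and $N$ such that for every $n\ge N$ and every integer $1\le k\le n$, the complete graph $K_n$ on $n$ vertices satisfies $S^k(K_n)\ge c\,k$. (b) For every fixed $d$ and every fixed $\lambda<d$ there exist constants $c>0$ and $N$ such that for every $n\ge N$, every expander $G$ on $n$ vertices with parameters $d,\lambda$ (that is, every $(n,d,\lambda)$-graph $G$), and every integer $1\le k\le n$, one has $S^k(G)\ge c\,k$. In short, $S^k(G)=\Omega(k)$ for $k\le n$ when $G$ is a complete graph or an expander.
   Context: A simple random walk on a finite graph moves at each step from the current vertex to a uniformly random neighbor (if a vertex has a loop, the vertex counts once among its own neighbors). For a finite connected graph $G$, a vertex $i$ and an integer $k\ge 1$, let $\tau_i^k$ be the first time by which every vertex of $G$ has been visited by at least one of $k$ independent simple random walks, all started at $i$ at time $0$ and moving simultaneously (one step each per time unit; the vertex occupied at time $0$ counts as visited). Put $C_i^k=E[\tau_i^k]$, $C^k(G)=\max_i C_i^k$, and $C(G)=C^1(G)$ (the cover time). The speed-up is $S^k(G)=C(G)/C^k(G)$. An $(n,d,\lambda)$-graph is a $d$-regular graph on $n$ vertices such that every nontrivial eigenvalue of its adjacency matrix (i.e. every eigenvalue other than the top eigenvalue $d$, counted with multiplicity) has absolute value at most $\lambda$. For $d$-regular graphs with a loop at every vertex, being an $(n,d,\lambda)$-graph for a fixed $\lambda$ bounded away from $d$ is equivalent to vertex expansion: every set $X$ of at most half the vertices has at least $c'|X|$ neighbors outside $X$, for a fixed $c'>0$. *)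

(* Defs.v *)
From HB Require Import structures.
From mathcomp Require Import all_boot all_order all_algebra.
From mathcomp Require Import all_classical all_reals all_analysis.
From mathcomp Require Import lra.

Set Implicit Arguments.
Unset Strict Implicit.
Unset Printing Implicit Defensive.
Import Order.TTheory GRing.Theory Num.Theory.

Local Open Scope classical_set_scope.
Local Open Scope ring_scope.

(* Finite graphs without multiple edges; loops are allowed. *)
Record graph (n : nat) := Graph {
  adj :> rel 'I_n;
  adj_sym : symmetric adj }.

Definition neighbors n (G : graph n) (u : 'I_n) : {set 'I_n} :=
  [set v | G u v]%SET.

Definition regular n (G : graph n) (d : nat) : Prop :=
  forall u, #|neighbors G u| = d.

Definition adjmx (R : realType) n (G : graph n) : 'M[R]_n :=
  \matrix_(u, v) (G u v)%:R.

(* An eigenvalue of the adjacency matrix of a d-regular graph which remains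
   after one copy of the eigenvalue d has been removed from the spectrum. *)
Definition nontrivial_eigenvalue (R : realType) n (G : graph n) (d : nat)
    (mu : R) : Prop :=
  eigenvalue (adjmx R G) mu /\
  (mu = d%:R -> (1 < mup mu (char_poly (adjmx R G)))%N).

Definition ndlambda_graph (R : realType) n (G : graph n) (d : nat)
    (lambda : R) : Prop :=
  regular G d /\
  forall mu : R, nontrivial_eigenvalue G d mu -> `|mu| <= lambda.

Lemma complete_sym n : symmetric (fun u v : 'I_n => u != v).
Proof. by move=> u v; rewrite eq_sym. Qed.

Definition complete n : graph n := Graph (@complete_sym n).

(* Convention: a walk stays put at an isolated vertex. *)
Definition moves n (G : graph n) (u : 'I_n) : {set 'I_n} :=
  if neighbors G u == finset.set0 then [set u]%SET else neighbors G u.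

Definition step_prob (R : realType) n (G : graph n) (u v : 'I_n) : R :=
  (v \in moves G u)%:R / #|moves G u|%:R.

(* The probability that a simple random walk started at i follows w up to
   time t. *)
Definition path_prob (R : realType) n (G : graph n) (i : 'I_n) (t : nat)
    (w : nat -> 'I_n) : R :=
  (w 0%N == i)%:R * \prod_(s < t) step_prob R G (w s) (w s.+1).

(* k independent simple random walks on G, all started at i, on some
   probability space.  Being a product, the joint law says both that each
   walk has the law of a simple random walk and that the walks are mutually
   independent. *)
Record walks (R : realType) n (G : graph n) (k : nat) (i : 'I_n) := Walks {
  walks_disp : measure_display;
  sample : measurableType walks_disp;
  Pr : probability sample R;
  pos : 'I_k -> nat -> sample -> 'I_n;
  measurable_pos : forall j t v, measurable [set om | pos j t om = v];
  pos_law : forall (t : nat) (w : 'I_k -> nat -> 'I_n),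
    Pr [set om | forall j s, (s <= t)%N -> pos j s om = w j s] =
    (\prod_(j < k) path_prob R G i t (w j))%:E }.

(* Existence of such walks. All k walks are read off one uniform point of
   [0, 1[: at a state with D successors, x = (m + y) / D with m < D and
   y in [0, 1[ selects the m-th successor and leaves y for the next step. *)

Definition digit_step (R : realType) (S : finType) (N : S -> {set S})
    (p : S * R) : S * R :=
  let x := p.2 * #|N p.1|%:R in
  (nth p.1 (enum (N p.1)) (Num.truncn x), x - (Num.truncn x)%:R).

Lemma digit_itv (R : realType) (S : finType) (N : S -> {set S})
    (N0 : forall s, (0 < #|N s|)%N) (t : nat) (s : S) (w : nat -> S) :
  exists a : R,
    let l := (w 0%N == s)%:R *
      \prod_(r < t) ((w r.+1 \in N (w r))%:R / #|N (w r)|%:R) in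
    [/\ 0 <= a, 0 <= l, a + l <= 1 & forall x : R, 0 <= x < 1 ->
      (forall r, (r <= t)%N -> (iter r (digit_step N) (s, x)).1 = w r) <->
      a <= x < a + l].
Proof.
elim: t s w => [|t IH] s w.
  exists 0; rewrite big_ord0 mulr1.
  have [/eqP e|ne] := eqVneq (w 0%N) s; split=> //=; try lra.
  - move=> x x01; split=> _; first by lra.
    by move=> r; rewrite leqn0 => /eqP ->; rewrite /= (eqP e).
  - move=> x x01; split=> [/(_ 0%N isT)/= h|]; last by lra.
    by rewrite -h eqxx in ne.
have [/eqP e|ne] := eqVneq (w 0%N) s; last first.
  exists 0; rewrite mul0r; split=> //; try lra.
  move=> x x01; split=> [/(_ 0%N isT)/= h|]; last by lra.
  by rewrite -h eqxx in ne.
set D : R := #|N s|%:R.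
have D0 : 0 < D by rewrite ltr0n.
have szN : size (enum (N s)) = #|N s| by rewrite cardE.
have step1 x : 0 <= x < 1 -> (Num.truncn (x * D) < #|N s|)%N.
  move=> /andP[x0 x1]; rewrite -(ltr_nat R) (@le_lt_trans _ _ (x * D)) //.
    by rewrite Num.Theory.truncn_le // mulr_ge0 // ltW.
  by rewrite gtr_pMl.
rewrite mul1r big_ord_recl /= (eqP e) -/D.
have [w1N|w1N] := boolP (w 1%N \in N s); last first.
  exists 0; rewrite !mul0r; split=> //; try lra.
  move=> x x01; split=> [/(_ 1%N isT)/= h|]; last by lra.
  move: w1N; rewrite -h -(mem_enum (N s)) mem_nth //.
  by rewrite szN step1.
have [a [a0 l0 al1 H]] := IH (w 1%N) (fun r => w r.+1).
move: l0 al1 H; rewrite eqxx !mul1r; set l := (X in 0 <= X) => l0 al1 H.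
set m := index (w 1%N) (enum (N s)).
have mN : (m < #|N s|)%N by rewrite -szN index_mem mem_enum.
have wm : nth s (enum (N s)) m = w 1%N by rewrite nth_index // mem_enum.
have mD : m%:R + 1 <= D by rewrite natr1 ler_nat.
have m0 : 0 <= m%:R :> R by rewrite ler0n.
have eal : (m%:R + a) / D + D^-1 * l = (m%:R + a + l) / D.
  by rewrite [_ * l]mulrC -mulrDl.
have lE : \prod_(i < t) ((w (bump 0 i).+1 \in N (w (bump 0 i)))%:R /
    #|N (w (bump 0 i))|%:R) = l by apply: eq_bigr.
rewrite lE; exists ((m%:R + a) / D); rewrite eal; split.
- by rewrite divr_ge0 ?addr_ge0 // ltW.
- by rewrite mulr_ge0 // invr_ge0 ltW.
- by rewrite ler_pdivrMr // mul1r; lra.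
move=> x x01.
rewrite ler_pdivrMr // ltr_pdivlMr //.
have first x' : Num.truncn (x' * D) = m ->
    digit_step N (s, x') = (w 1%N, x' * D - m%:R).
  by rewrite /digit_step /= -/D => ->; rewrite wm.
have xD : 0 <= x * D by rewrite mulr_ge0 ?(ltW D0) //; case/andP: x01.
split=> [h|h].
  have mE : Num.truncn (x * D) = m.
    apply/eqP; rewrite -(nth_uniq s _ _ (enum_uniq (N s))) ?szN ?step1 // wm.
    by have /= <- := h 1%N isT.
  have [t1 t2] := andP (Num.Theory.truncn_itv xD); rewrite mE -natr1 in t1 t2.
  have y01 : 0 <= x * D - m%:R < 1 by lra.
  have /(H _ y01) : forall r, (r <= t)%N ->
      (iter r (digit_step N) (w 1%N, x * D - m%:R)).1 = w r.+1.
    by move=> r rt; rewrite -(first x mE) -iterSr h.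
  by lra.
have mE : Num.truncn (x * D) = m by apply: Num.Theory.truncn_def; rewrite -natr1; lra.
have y01 : 0 <= x * D - m%:R < 1 by lra.
move=> [_|r rt]; first by rewrite /= (eqP e).
rewrite iterSr (first x mE).
by apply: (H _ y01).2 => //; lra.
Qed.

Section unit_interval.
Variable R : realType.

Definition unit_measure : set (measurableTypeR R) -> \bar R :=
  mrestr lebesgue_measure (measurable_itv `[(0 : R), 1[).

HB.instance Definition _ := Measure.on unit_measure.

Let unit_measureT : unit_measure [set: R] = 1%E.
Proof.
rewrite /unit_measure /mrestr setTI lebesgue_measure_itv /= lte_fin ltr01.
by rewrite oppr0 adde0.
Qed.

HB.instance Definition _ :=
  @Measure_isProbability.Build _ _ _ unit_measure unit_measureT.

End unit_interval.

Section joint_walk.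
Variables (R : realType) (n : nat) (G : graph n) (k : nat) (i : 'I_n).

Let S := {ffun 'I_k -> 'I_n}.
Let N (f : S) : {set S} := [set g : S | [forall j, g j \in moves G (f j)]]%SET.

Let card_N f : #|N f| = (\prod_j #|moves G (f j)|)%N.
Proof.
transitivity #|family (fun j => mem (moves G (f j)))|.
  by apply: eq_card => g; rewrite !inE.
by rewrite card_family foldrE big_image.
Qed.

Let moves_gt0 u : (0 < #|moves G u|)%N.
Proof. by rewrite /moves; case: ifPn; rewrite ?cards1 // -card_gt0. Qed.

Let N_gt0 f : (0 < #|N f|)%N.
Proof. by rewrite card_N prodn_gt0. Qed.

Let start : S := [ffun=> i].
Let traj (t : nat) (x : R) : S := (iter t (digit_step N) (start, x)).1.
Let clamp (x : R) : R := if 0 <= x < 1 then x else 0.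

Let weight t (w : nat -> S) : R := (w 0%N == start)%:R *
  \prod_(r < t) ((w r.+1 \in N (w r))%:R / #|N (w r)|%:R).

Let path_itv t (w : nat -> S) : exists2 a : R, 0 <= weight t w &
  `[0, 1[%classic `&` [set x | forall r, (r <= t)%N -> traj r x = w r] =
  `[a, a + weight t w[%classic.
Proof.
have [a [a0 l0 al1 H]] := digit_itv R N_gt0 t start w.
exists a => //; apply/seteqP; split=> x /=; rewrite !in_itv /=.
  by case=> x01 h; apply/(H _ x01).
rewrite -/(weight t w) in al1 * => h.
have x01 : 0 <= x < 1 by lra.
by split=> //; apply/(H _ x01).
Qed.

Let measurable_traj t (P : set S) :
  measurable (`[0, 1[%classic `&` [set x | P (traj t x)]).
Proof.
rewrite (_ : _ `&` _ = \bigcup_(w in [set w : {ffun 'I_t.+1 -> S} | P (w ord_max)])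
    (`[0, 1[%classic `&`
     [set x | forall r, (r <= t)%N -> traj r x = w (inord r)])).
  apply: fin_bigcup_measurable; first exact: finite_finset.
  move=> w _; have [a _ ->] := path_itv t (fun r => w (inord r)).
  exact: measurable_itv.
apply/seteqP; split=> x /=.
  move=> [x01 Px]; exists [ffun r : 'I_t.+1 => traj r x]; first by rewrite /= ffunE.
  by split=> // r rt; rewrite ffunE inordK.
move=> [w /= Pw [x01 h]]; split=> //; rewrite h //.
by rewrite (_ : inord t = ord_max) //; apply/val_inj; rewrite /= inordK.
Qed.

Let position (j : 'I_k) (t : nat) (x : measurableTypeR R) : 'I_n :=
  traj t (clamp x) j.

Let measurable_position j t v : measurable [set x | position j t x = v].
Proof.
rewrite (_ : [set _ | _] =
    (`[0, 1[%classic `&` [set x | (fun f : S => f j = v) (traj t x)]) `|`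
    (~` `[0, 1[%classic `&` [set _ | position j t 1 = v])).
  apply: measurableU; first exact: (measurable_traj t (fun f : S => f j = v)).
  apply: measurableI; first by apply: measurableC; exact: measurable_itv.
  have [e|e] := pselect (position j t 1 = v).
    by rewrite (_ : [set _ | _] = setT) //; apply/seteqP; split.
  by rewrite (_ : [set _ | _] = set0) //; apply/seteqP; split.
apply/seteqP; split=> x; rewrite /position /clamp /= in_itv /= ltxx andbF;
  case: ifPn => [x01|x01]; try by [left|right].
- by move=> [[]|[]].
- by move=> [[]|[]].
Qed.

Let position_law t (w : 'I_k -> nat -> 'I_n) :
  unit_measure [set x | forall j s, (s <= t)%N -> position j s x = w j s] =
  (\prod_(j < k) path_prob R G i t (w j))%:E.
Proof.
pose f s : S := [ffun j => w j s].
have -> : \prod_(j < k) path_prob R G i t (w j) = weight t f.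
  rewrite /weight /path_prob big_split /=; congr (_ * _).
    have [/ffunP e|ne] := eqVneq (f 0%N) start.
      by rewrite big1 // => j _; have := e j; rewrite !ffunE => ->; rewrite eqxx.
    have [j hj] : exists j, w j 0%N != i.
      apply/existsP; apply: contraNT ne; rewrite negb_exists => /forallP h.
      by apply/eqP/ffunP => j; rewrite !ffunE; have := h j; rewrite negbK => /eqP.
    by rewrite (bigD1 j) //= (negbTE hj) mul0r.
  rewrite exchange_big /=; apply: eq_bigr => s _.
  rewrite /step_prob big_split /= prodfV card_N natr_prod; congr (_ / _).
    case: (boolP (f s.+1 \in N (f s))); rewrite inE.
      move=> /forallP h.
      by rewrite big1 // => j _; have := h j; rewrite !ffunE => ->.
    rewrite negb_forall => /existsP[j]; rewrite !ffunE => /negbTE h.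
    by rewrite (bigD1 j) //= h mul0r.
  by apply: eq_bigr => j _; rewrite ffunE.
have [a l0 e] := path_itv t f.
rewrite /unit_measure /mrestr.
rewrite (_ : _ `&` _ = `[a, a + weight t f[%classic); last first.
  rewrite -e setIC; apply/seteqP; split=> x /=;
    rewrite !in_itv /= /position /clamp => -[x01 h]; split=> //.
    by move=> r rt; apply/ffunP => j; rewrite ffunE -(h j r rt) x01.
  by move=> j r rt; rewrite x01 (h r rt) ffunE.
rewrite lebesgue_measure_itv /= lte_fin ltrDl lt_neqAle l0 andbT.
by case: eqVneq => [<-//|_] /=; rewrite -EFinB addrAC subrr add0r.
Qed.

(* Opaque: only the properties recorded in walks can be used. *)
Definition independent_walks : walks R G k i.
Proof. exact: (Walks measurable_position position_law). Qed.

End joint_walk.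

(* The first time by which every vertex has been visited; +oo if none. *)
Definition cover_rv (R : realType) n (G : graph n) k i (W : walks R G k i)
    (om : sample W) : \bar R :=
  ereal_inf [set t%:R%:E | t in [set t : nat |
    forall v, exists j s, (s <= t)%N /\ @pos _ _ _ _ _ W j s om = v]].

Definition cover_time_from (R : realType) n (G : graph n) (k : nat) (i : 'I_n)
    : \bar R :=
  (\int[Pr (independent_walks R G k i)]_om cover_rv om)%E.

Definition cover_time (R : realType) n (G : graph n) (k : nat) : \bar R :=
  \big[maxe/-oo%E]_(i < n) cover_time_from R G k i.

(* Both cover times are finite when G is connected. *)
Definition speedup (R : realType) n (G : graph n) (k : nat) : R :=
  fine (cover_time R G 1) / fine (cover_time R G k).

(* Main.v *)
Require Import Defs.
From mathcomp Require Import all_boot all_order all_algebra.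
From mathcomp Require Import all_classical all_reals all_analysis.
From mathcomp Require Import measurable_realfun complex.
From mathcomp Require Import ring lra zify.

(* A regular graph whose transition matrix contracts mean-zero functions in l2
   by a fixed factor rho < 1 has linear speed-up; K_n and (n, d, lambda)-graphs
   are instances, with rho = 1/2 and rho = lambda / d.

   Upper bound on C^k: killing the walk at a vertex v leaves an operator of l2
   norm at most 1 - delta / n.  After O(log n) steps the walk is so well mixed
   that its probability of missing v during t further steps is at most
   (1 + 1/n) (1 - delta / n)^t.  For k <= n independent walks the k-th power of
   this is at most e exp(- delta k t / n); a union bound over v and a sum over t
   give C^k = O(n log n / k).

   Lower bound on C^1: if m vertices are unvisited and m exceeds a constant, the
   expected number of visits to them during n / 8 steps is at most m / 4, so
   halving the unvisited set takes expected time at least n / 16.  There are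
   about log n halvings. *)

Set Implicit Arguments.
Unset Strict Implicit.
Unset Printing Implicit Defensive.
Import Order.TTheory GRing.Theory Num.Theory.

Local Open Scope ring_scope.

(** * Spectral gap of symmetric matrices *)

Lemma char_poly_conj (F : fieldType) n (P A : 'M[F]_n) : P \in unitmx ->
  char_poly (invmx P *m A *m P) = char_poly A.
Proof.
move=> Pu; rewrite /char_poly.
have -> : char_poly_mx (invmx P *m A *m P) =
    map_mx polyC (invmx P) *m char_poly_mx A *m map_mx polyC P.
  rewrite /char_poly_mx mulmxBr mulmxBl !map_mxM; congr (_ - _).
  by rewrite scalar_mxC -mulmxA -map_mxM mulVmx ?mulmx1 // map_mx1 mulmx1.
by rewrite !det_mulmx mulrAC -det_mulmx -map_mxM mulVmx // map_mx1 det1 mul1r.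
Qed.

Lemma char_poly_diag (F : fieldType) n (s : 'rV[F]_n) :
  char_poly (diag_mx s) = \prod_i ('X - (s 0 i)%:P).
Proof.
rewrite char_poly_trig; last exact/is_diag_mx_is_trig/diag_mx_is_diag.
by apply: eq_bigr => i _; rewrite mxE eqxx.
Qed.

Section symmetric_contraction.
Local Open Scope sesquilinear_scope.

Variables (R : rcfType) (n : nat) (A : 'M[R]_n).
Hypothesis A_sym : A^T = A.

Local Notation C := R[i].
Local Notation toC := (real_complex R).
(** Unitary diagonalization is applied to the complexification [B]. It is Hermitian, so its
    eigenvalues are real, and [mu] brings them back to [R]. *)
Let B : 'M[C]_n := map_mx toC A.
Let P := spectralmx B.
Let s := spectral_diag B.

Let B_herm : B \is hermsymmx.
Proof.
apply: realsym_hermsym; last by apply/mxOverP => i j; rewrite mxE complex_real.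
by apply/is_hermitianmxP; rewrite expr0 scale1r map_mx_id // /B map_trmx A_sym.
Qed.

Let BE : B = P^t* *m diag_mx s *m P.
Proof.
have /orthomx_spectralP := hermitian_normalmx B_herm.
by rewrite invmx_unitary ?spectral_unitarymx.
Qed.

Let mu i : R := complex.Re (s 0 i).

Let muE i : s 0 i = (mu i)%:C%C.
Proof.
by rewrite RRe_real //; apply: (mxOverP (hermitian_spectral_diag_real B_herm)).
Qed.

Let char_polyC : map_poly toC (char_poly A) = \prod_i ('X - (s 0 i)%:P).
Proof.
rewrite map_char_poly -/B BE -(invmx_unitary (spectral_unitarymx B)).
by rewrite char_poly_conj ?spectral_unit // char_poly_diag.
Qed.

Let mu_eigen i : eigenvalue A (mu i).
Proof.
rewrite eigenvalue_root_char -(fmorph_root toC) char_polyC.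
by rewrite (bigD1 i) //= rootM /= -muE root_XsubC eqxx.
Qed.

(** Each index contributes one linear factor to the characteristic polynomial, so a value taken at
    two indices is a multiple root. *)
Let mu_mult i j : i != j -> mu i = mu j -> (1 < mup (mu i) (char_poly A))%N.
Proof.
move=> ij mij; rewrite mup_geq ?monic_neq0 ?char_poly_monic //.
rewrite -(dvdp_map toC) char_polyC rmorphXn /= map_polyXsubC /=.
rewrite (bigD1 j) //= (bigD1 i) //= mulrA !muE mij dvdp_mulr //.
Qed.

Let sqnC (w : 'rV[C]_n) : C := \sum_i `|w 0 i| ^+ 2.

Let sqnCE w : sqnC w = (w *m w^t*) 0 0.
Proof. by rewrite mxE; apply: eq_bigr => i _; rewrite !mxE normCK. Qed.

Let sqnC_unitary w : sqnC (w *m P^t*) = sqnC w.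
Proof.
rewrite !sqnCE trmx_mul map_mxM trmxCK mulmxA mulmxKtV ?spectral_unitarymx //.
Qed.

Let sqnC_real (w : 'rV[R]_n) :
  sqnC (map_mx toC w) = (\sum_i w 0 i ^+ 2)%:C%C.
Proof.
rewrite rmorph_sum; apply: eq_bigr => i _.
by rewrite mxE sqr_normc conjc_real -rmorphM /= expr2.
Qed.

(** In an orthonormal eigenbasis, [x] has a nonzero coordinate at some [i0], whose eigenvalue is
    then [d]. All other eigenvalues are at most [lambda < d] in absolute value, so [x] is supported
    on [i0] alone, and a vector orthogonal to [x] has only contracted coordinates. *)
Lemma symmetric_spectral_gap (x : 'rV[R]_n) (d lambda : R) :
  (1 < n)%N -> x != 0 -> x *m A = d *: x -> lambda < d ->
  (forall m : R, eigenvalue A m /\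
     (m = d -> (1 < mup m (char_poly A))%N) -> `|m| <= lambda) ->
  0 <= lambda /\ forall f : 'rV[R]_n, f *m x^T = 0 ->
    \sum_i (f *m A) 0 i ^+ 2 <= lambda ^+ 2 * \sum_i f 0 i ^+ 2.
Proof.
move=> n1 x0 xA ltd Hl.
pose coord (w : 'rV[R]_n) := map_mx toC w *m P^t*.
have coordA w : coord (w *m A) = coord w *m diag_mx s.
  rewrite /coord map_mxM -/B BE !mulmxA mulmxtVK ?spectral_unitarymx //.
have x_ne : coord x != 0.
  apply: contra_neq x0 => /(congr1 (mulmx^~ P)).
  rewrite mulmxKtV ?spectral_unitarymx // mul0mx => /eqP.
  by rewrite map_mx_eq0 => /eqP.
have [i0 xi0] : exists i0, coord x 0 i0 != 0 by apply/rV0Pn.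
have xj j : coord x 0 j != 0 -> mu j = d.
  move=> xj0; have := coordA x; rewrite xA /coord map_mxZ /= -scalemxAl.
  move=> /rowP/(_ j); rewrite mxE mul_mx_diag [in RHS]mxE muE mulrC.
  by move=> /(mulfI xj0)/complexI ->.
(* If [mu j = d], the indices [i0] and [j] make [d] a multiple root, so the hypothesis applies in
   this case too. *)
have lam j : j != i0 -> `|mu j| <= lambda.
  move=> ji; apply: Hl; split=> // e; apply: (mu_mult ji).
  by rewrite (xj i0).
have xj0 j : j != i0 -> coord x 0 j = 0.
  move=> /lam le; apply/eqP; apply: contraTT (le_lt_trans le ltd).
  by move=> /xj ->; rewrite -leNgt ler_norm.
split.
  (* A second index, available because [1 < n], bounds [lambda] from below by an absolute value. *)
  have [j ji] : exists j, j != i0.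
    have : (0 < #|~: [set i0]%SET|)%N by rewrite cardsC1 card_ord; case: (n) n1.
    by case/card_gt0P => j; rewrite !inE; exists j.
  exact: le_trans (lam j ji).
move=> f fx.
have fi0 : coord f 0 i0 = 0.
  have : (coord f *m (coord x)^t*) 0 0 = 0.
    rewrite /coord trmx_mul map_mxM trmxCK mulmxA mulmxKtV ?spectral_unitarymx //.
    have -> : (map_mx toC x)^t* = map_mx toC x^T.
      by apply/matrixP => a b; rewrite !mxE; exact: conjc_real.
    by rewrite -map_mxM fx !mxE.
  move: (coord f) (coord x) xi0 xj0 => a b bi0 bj0.
  rewrite mxE (bigD1 i0) //= big1 => [|j ji]; last first.
    by rewrite !mxE bj0 // conjC0 mulr0.
  rewrite addr0 !mxE => /eqP; rewrite mulf_eq0 conjC_eq0 (negbTE bi0) orbF.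
  by move/eqP.
(* Parseval: the change of basis preserves sums of squares, so the bound can be checked coordinate
   by coordinate. *)
rewrite -lecR rmorphM /= -!sqnC_real -(sqnC_unitary (map_mx toC f)).
rewrite -(sqnC_unitary (map_mx toC (f *m A))) -!/(coord _) coordA /sqnC mulr_sumr.
apply: ler_sum => i _; rewrite mul_mx_diag mxE normrM exprMn mulrC.
have [->|ii0] := eqVneq i i0; first by rewrite fi0 normr0 expr0n /= !mulr0.
rewrite ler_wpM2r ?exprn_ge0 // muE normc_def /= expr0n addr0 sqrtr_sqr.
by rewrite -rmorphXn /= lecR lerXn2r ?nnegrE ?lam // (le_trans _ (lam i ii0)).
Qed.

End symmetric_contraction.

(** * Walk operators on functions *)

Section kernel_operator.
Variables (R : rcfType) (V : finType) (p : V -> V -> R).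

Definition ker_op (f : V -> R) (u : V) : R := \sum_v p u v * f v.

Definition sqnorm (f : V -> R) : R := \sum_u f u ^+ 2.

Definition indic (A : {set V}) (u : V) : R := (u \in A)%:R.

Definition l2_contraction (rho : R) : Prop :=
  forall f, \sum_u f u = 0 -> sqnorm (ker_op f) <= rho ^+ 2 * sqnorm f.

(** The probability that the walk from [u] misses [x] at all times from 0 to [t], through the kernel
    killed at [x]. *)
Fixpoint avoid (x : V) (t : nat) (u : V) : R :=
  (u != x)%:R * (if t is t'.+1 then ker_op (avoid x t') u else 1).

(* With U the set of vertices not visited so far and u the current vertex, the
   expectation of phi at the set of vertices still unvisited t steps later. *)
Fixpoint unvisited_mean (phi : {set V} -> R) (t : nat) (u : V) (U : {set V}) : R :=
  if t is t'.+1 then \sum_v p u v * unvisited_mean phi t' v (U :\ v) else phi U.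

(* The expectation of min(t, tau), tau being the time needed to visit all of U. *)
Definition cover_mean (t : nat) (u : V) (U : {set V}) : R :=
  \sum_(s < t) unvisited_mean (fun A => (A != finset.set0)%:R) s u U.

(* The expectation of min(t, sigma), sigma being the first time at which at
   most b vertices of U are left. *)
Fixpoint shrink_mean (b t : nat) (u : V) (U : {set V}) : R :=
  if t is t'.+1 then
    (b < #|U|)%N%:R * (1 + \sum_v p u v * shrink_mean b t' v (U :\ v))
  else 0.

Hypothesis p_ge0 : forall u v, 0 <= p u v.
Hypothesis p_sum1 : forall u, \sum_v p u v = 1.

Lemma ker_opB f c u : ker_op (fun v => f v - c) u = ker_op f u - c.
Proof.
rewrite /ker_op -[c in RHS]mul1r -(p_sum1 u) mulr_suml -sumrB.
by apply: eq_bigr => v _; rewrite mulrBr.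
Qed.

Lemma iter_ker_opB s f c u :
  iter s ker_op (fun v => f v - c) u = iter s ker_op f u - c.
Proof.
elim: s u => [//|s IH] u; rewrite !iterS -ker_opB.
by apply: eq_bigr => v _; rewrite IH.
Qed.

Lemma ler_ker_op f g u : (forall v, f v <= g v) -> ker_op f u <= ker_op g u.
Proof. by move=> fg; apply: ler_sum => v _; rewrite ler_wpM2l. Qed.

Lemma sqnorm_ge0 f : 0 <= sqnorm f.
Proof. by apply: sumr_ge0 => u _; rewrite sqr_ge0. Qed.

Lemma sqr_le_sqnorm f u : f u ^+ 2 <= sqnorm f.
Proof.
rewrite /sqnorm (bigD1 u) //= lerDl.
by apply: sumr_ge0 => v _; rewrite sqr_ge0.
Qed.

Lemma sqnorm_indic A : sqnorm (indic A) = #|A|%:R.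
Proof.
rewrite /sqnorm -sum1_card natr_sum [RHS]big_mkcond /=; apply: eq_bigr => u _.
by rewrite /indic; case: ifP => _; rewrite ?expr1n ?expr0n.
Qed.

Lemma avoid_ge0 x t u : 0 <= avoid x t u.
Proof.
elim: t u => [|t IH] u /=; rewrite mulr_ge0 //.
by apply: sumr_ge0 => v _; rewrite mulr_ge0.
Qed.

(** Dropping the killing during the first [s] steps can only increase the value, and leaves these
    steps free for mixing. *)
Lemma avoidD x s t u : avoid x (s + t) u <= iter s ker_op (avoid x t) u.
Proof.
elim: s u => [//|s IH] u; rewrite addSn iterS /=.
apply: le_trans (ler_ker_op u IH); rewrite ler_piMl ?lern1 ?leq_b1 //.
by apply: sumr_ge0 => v _; rewrite mulr_ge0 ?avoid_ge0.
Qed.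

Lemma unvisited_mean_ge0 phi t u U :
  (forall A, 0 <= phi A) -> 0 <= unvisited_mean phi t u U.
Proof.
move=> phi0; elim: t u U => [//|t IH] u U /=.
by apply: sumr_ge0 => v _; rewrite mulr_ge0.
Qed.

(** A vertex [x] stays unvisited when it was so at the outset and the walk misses it. As [avoid]
    also tests time 0, the start [u] has to be outside [U]. *)
Lemma unvisited_mean_mem x t u (U : {set V}) : u \notin U ->
  unvisited_mean (fun A => (x \in A)%:R) t u U = (x \in U)%:R * avoid x t u.
Proof.
elim: t u U => [|t IH] u U uU /=; have [xU|xU] := boolP (x \in U);
  rewrite ?mul0r ?mul1r ?mulr1 //.
- by rewrite (memPnC uU).
- rewrite (memPnC uU _ xU) mul1r; apply: eq_bigr => v _.
  rewrite IH ?finset.setD11 // !inE xU andbT eq_sym.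
  have [->|_] := eqVneq v x; last by rewrite mul1r.
  by rewrite mul0r; case: t {IH} => [|t] /=; rewrite eqxx !mul0r.
rewrite big1 // => v _.
by rewrite IH ?finset.setD11 // !inE (negbTE xU) andbF mul0r mulr0.
Qed.

Lemma cover_mean_homo t t' u U : (t <= t')%N -> cover_mean t u U <= cover_mean t' u U.
Proof.
move=> /subnKC <-; rewrite /cover_mean big_split_ord /= lerDl.
by apply: sumr_ge0 => s _; rewrite unvisited_mean_ge0.
Qed.

Lemma cover_meanS t u U : U != finset.set0 ->
  cover_mean t.+1 u U = 1 + \sum_v p u v * cover_mean t v (U :\ v).
Proof.
move=> U0; rewrite /cover_mean big_ord_recl /= U0; congr (_ + _).
by rewrite exchange_big /=; apply: eq_bigr => v _; rewrite mulr_sumr.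
Qed.

(** Markov property at the first time when at most [b] vertices are left, cut off at [T]. A step
    removes at most one vertex, so at least [b] remain at that time and the rest contributes at
    least [C]. *)
Lemma cover_mean_shrink b t T (C : R) :
  (forall u (U : {set V}), (b <= #|U|)%N -> C <= cover_mean t u U) ->
  forall u (U : {set V}), (b <= #|U|)%N ->
  shrink_mean b T u U + C <= cover_mean (T + t) u U.
Proof.
move=> HC; elim: T => [|T IH] u U bU; first by rewrite /= add0r HC.
rewrite /=; case: ltnP => [ltbU|_]; last first.
  by rewrite mul0r add0r (le_trans (HC u U bU)) // cover_mean_homo // leq_addl.
rewrite addSn cover_meanS; last by rewrite -card_gt0 (leq_ltn_trans _ ltbU).
rewrite mul1r -addrA lerD2l -[C in leLHS]mul1r -(p_sum1 u) mulr_suml -big_split /=.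
apply: ler_sum => v _; rewrite -mulrDr ler_wpM2l // IH //.
by have := cardsD1 v U; lia.
Qed.

(* Up to time sigma, every decrease of the unvisited set is a visit to A. *)
Lemma shrink_mean_ge b T (A : {set V}) t u (U : {set V}) :
  (t <= T)%N -> (b < #|A|)%N -> U \subset A -> (b <= #|U|)%N ->
  t%:R - T%:R / (#|A|%:R - b%:R) *
    (\sum_(s < t) iter s.+1 ker_op (indic A) u + #|A|%:R - #|U|%:R)
  <= shrink_mean b t u U.
Proof.
move=> tT bA; set K := T%:R / _.
have x0 : 0 < #|A|%:R - b%:R :> R by rewrite subr_gt0 ltr_nat.
have K0 : 0 <= K by rewrite divr_ge0 ?ler0n // ltW.
have occ0 t' u' : 0 <= \sum_(s < t') iter s.+1 ker_op (indic A) u'.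
  apply: sumr_ge0 => s _; elim: {s}(s.+1) u' => [|s IH] v; first exact: ler0n.
  by rewrite iterS sumr_ge0 // => w _; rewrite mulr_ge0.
elim: t u U tT => [|t IH] u U tT UA bU.
  rewrite /= sub0r oppr_le0 big_ord0 add0r mulr_ge0 // subr_ge0 ler_nat.
  exact: subset_leq_card.
rewrite /=; have [ltbU|leUb] := ltnP b #|U|; last first.
  (* [K] is scaled so that [K] times [#|A| - b] is [T]; with only [b] vertices left, the left side
     is therefore at most [t.+1 - T <= 0]. *)
  have -> : #|U| = b by lia.
  rewrite mul0r -addrA mulrDr divfK ?gt_eqF //.
  have : t.+1%:R <= T%:R :> R by rewrite ler_nat.
  have : 0 <= K * \sum_(s < t.+1) iter s.+1 ker_op (indic A) u by rewrite mulr_ge0.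
  lra.
rewrite mul1r; set occ := fun u => \sum_(s < t) iter s.+1 ker_op (indic A) u.
have -> : \sum_(s < t.+1) iter s.+1 ker_op (indic A) u =
    \sum_v p u v * (indic A v + occ v).
  rewrite big_ord_recl /= /occ.
  under [RHS]eq_bigr do rewrite mulrDr.
  rewrite big_split /=; congr (_ + _).
  rewrite -[LHS]/(\sum_(s < t) \sum_v p u v * iter s.+1 ker_op (indic A) v).
  by rewrite exchange_big /=; apply: eq_bigr => v _; rewrite mulr_sumr.
have -> : t.+1%:R - K * (\sum_v p u v * (indic A v + occ v) + #|A|%:R - #|U|%:R) =
   1 + \sum_v p u v * (t%:R - K * (indic A v + occ v + #|A|%:R - #|U|%:R)).
  under [in RHS]eq_bigr do rewrite mulrBr.
  rewrite sumrB -mulr_suml p_sum1 mul1r -natr1.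
  under [X in _ = _ + (_ - X)]eq_bigr do rewrite mulrCA -addrA mulrDr.
  rewrite -mulr_sumr big_split /= -mulr_suml p_sum1; lra.
rewrite lerD2l; apply: ler_sum => v _; rewrite ler_wpM2l //.
apply: le_trans (IH v (U :\ v) _ _ _); last 3 first.
- exact: ltnW.
- exact: fintype.subset_trans (finset.subsetDl _ _) UA.
- by have := cardsD1 v U; lia.
rewrite lerD2l lerN2 ler_wpM2l // (cardsD1 v U) natrD /indic -/(occ v).
have : (v \in U)%:R <= (v \in A)%:R :> R.
  by rewrite ler_nat; case: (boolP (v \in U)) => // /(fintype.subsetP UA) ->.
lra.
Qed.

(** * Mixing, killing and visit counts for a symmetric contracting kernel *)

Hypothesis p_sym : forall u v, p u v = p v u.
Variable rho : R.
Hypotheses (rho01 : 0 <= rho < 1) (p_contr : l2_contraction rho).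

Local Notation N := #|V|.
Let mean (f : V -> R) : R := (\sum_u f u) / N%:R.

(** Symmetry makes the kernel doubly stochastic; mean-zero functions thus stay mean-zero and the
    contraction can be iterated. *)
Lemma sum_ker_op f : \sum_u ker_op f u = \sum_u f u.
Proof.
rewrite /ker_op exchange_big /=; apply: eq_bigr => v _.
by rewrite -mulr_suml; under eq_bigr do rewrite p_sym; rewrite p_sum1 mul1r.
Qed.

Lemma iter_ker_op_contract s f : \sum_u f u = 0 ->
  sqnorm (iter s ker_op f) <= (rho ^+ s) ^+ 2 * sqnorm f.
Proof.
move=> f0; have sum0 t : \sum_u iter t ker_op f u = 0.
  by elim: t => [//|t IH]; rewrite iterS sum_ker_op.
elim: s => [|s IH]; first by rewrite expr0 expr1n mul1r.
rewrite iterS (le_trans (p_contr (sum0 s))) // (exprS _ s) exprMn.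
rewrite -[leRHS]mulrA ler_wpM2l //.
exact: sqr_ge0.
Qed.

Hypothesis N_gt0 : (0 < N)%N.

Lemma sum_center f : \sum_u (f u - mean f) = 0.
Proof.
rewrite sumrB sumr_const -[mean f *+ _]mulr_natr /mean divfK ?subrr //.
by rewrite pnatr_eq0 -lt0n.
Qed.

Lemma sqnorm_center f :
  sqnorm (fun u => f u - mean f) = sqnorm f - N%:R * mean f ^+ 2.
Proof.
have e : \sum_u f u = mean f * N%:R by rewrite divfK // pnatr_eq0 -lt0n.
rewrite /sqnorm; under eq_bigr do rewrite sqrrB.
rewrite big_split /= sumrB.
have -> : \sum_u f u * mean f *+ 2 = mean f * N%:R * mean f *+ 2.
  by rewrite -e mulr_suml -sumrMnl.
have -> : \sum_(u : V) mean f ^+ 2 = N%:R * mean f ^+ 2.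
  by rewrite sumr_const mulr_natl.
by ring.
Qed.

(** The centred function shrinks by [rho] per step in l2, and each single value is bounded by the l2
    norm. *)
Lemma iter_ker_op_le s f u :
  iter s ker_op f u <= mean f + rho ^+ s * Num.sqrt (sqnorm f).
Proof.
have /andP[r0 _] := rho01.
rewrite -lerBlDl -(iter_ker_opB s f (mean f) u).
have h : iter s ker_op (fun v => f v - mean f) u ^+ 2 <=
    (rho ^+ s * Num.sqrt (sqnorm f)) ^+ 2.
  rewrite exprMn sqr_sqrtr ?sqnorm_ge0 //.
  apply: le_trans (sqr_le_sqnorm _ u) _.
  apply: le_trans (iter_ker_op_contract s (sum_center f)) _.
  rewrite ler_wpM2l ?sqr_ge0 // sqnorm_center gerBl.
  by rewrite mulr_ge0 ?sqr_ge0.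
apply: le_trans (ler_norm _) _; rewrite -sqrtr_sqr.
rewrite -(ger0_norm (mulr_ge0 (exprn_ge0 s r0) (sqrtr_ge0 _))) -sqrtr_sqr.
exact: ler_wsqrtr.
Qed.

Let delta : R := (1 - rho ^+ 2) / 4.

(** Split [f] into its mean and its centred part. The centred part is contracted by [rho]; the
    constant part is not, but a function vanishing at [x] cannot be constant, and at least a
    fraction [1 / (2 N)] of its square norm lies in the centred part. *)
Lemma killed_contraction f x : f x = 0 ->
  sqnorm (ker_op f) <= (1 - delta / N%:R) ^+ 2 * sqnorm f.
Proof.
move=> fx0; have NR1 : 1 <= N%:R :> R by rewrite ler1n.
have NR0 : 0 < N%:R :> R by lra.
have e : \sum_u f u = mean f * N%:R by rewrite divfK ?gt_eqF.
(* Cauchy-Schwarz on the [N - 1] vertices other than [x], obtained by expanding the square norm of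
   [f] minus its mean off [x]. *)
have CS : (N%:R + 1) * mean f ^+ 2 <= sqnorm f.
  have : 0 <= sqnorm (fun u => f u - mean f * (u != x)%:R) by exact: sqnorm_ge0.
  have -> : sqnorm (fun u => f u - mean f * (u != x)%:R) =
      sqnorm f - (mean f *+ 2) * (\sum_u f u) + mean f ^+ 2 * (N%:R - 1).
    have -> : N%:R - 1 = \sum_u (u != x)%:R :> R.
      rewrite -natr_sum -(natrB _ N_gt0) subn1 -(cardsC1 x) -sum1_card.
      by rewrite big_mkcond /=; congr (_%:R); apply: eq_bigr => u _; rewrite !inE.
    rewrite /sqnorm !mulr_sumr -sumrB -big_split /=; apply: eq_bigr => u _.
    by have [->|_] := eqVneq u x; rewrite ?fx0 /=; ring.
  rewrite e; lra.
have := p_contr (sum_center f); rewrite sqnorm_center.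
have mE : mean (ker_op f) = mean f by rewrite /mean sum_ker_op.
have -> : sqnorm (ker_op (fun u => f u - mean f)) =
    sqnorm (ker_op f) - N%:R * mean f ^+ 2.
  by rewrite -mE -sqnorm_center; apply: eq_bigr => u _; rewrite ker_opB mE.
have q0 := sqnorm_ge0 f; have /andP[r0 r1] := rho01.
move: (sqnorm f) (sqnorm (ker_op f)) (mean f) CS q0 => q Q m CS q0 Hc.
have d0 : 0 < 1 - rho ^+ 2 by nra.
have N20 : N%:R * m ^+ 2 <= (1 - (N%:R *+ 2)^-1) * q.
  have -> : (1 - (N%:R *+ 2)^-1) * q = q - q / (N%:R *+ 2) by ring.
  rewrite lerBrDr -lerBrDl ler_pdivrMr ?mulrn_wgt0 //.
  nra.
have : (1 - rho ^+ 2) * (N%:R * m ^+ 2) <=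
    (1 - rho ^+ 2) * ((1 - (N%:R *+ 2)^-1) * q) by rewrite ler_wpM2l // ltW.
(* The 4 in [delta] makes the gain [(1 - rho ^+ 2) / (2 N)] equal to the linear term [2 delta / N]
   of this square. *)
have -> : (1 - delta / N%:R) ^+ 2 =
    1 - (1 - rho ^+ 2) * (N%:R *+ 2)^-1 + (delta / N%:R) ^+ 2.
  by rewrite /delta; field; rewrite gt_eqF.
have : 0 <= (delta / N%:R) ^+ 2 * q by rewrite mulr_ge0 ?sqr_ge0.
lra.
Qed.

Lemma delta_bounds : 0 < delta <= 1 / 4.
Proof. by have /andP[r0 r1] := rho01; rewrite /delta; apply/andP; split; nra. Qed.

Lemma killing_rate_ge0 : 0 <= 1 - delta / N%:R.
Proof.
have NR1 : 1 <= N%:R :> R by rewrite ler1n.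
have /andP[d0 d1] := delta_bounds.
by rewrite subr_ge0 ler_pdivrMr; lra.
Qed.

Lemma sqnorm_avoid x t :
  sqnorm (avoid x t) <= ((1 - delta / N%:R) ^+ t) ^+ 2 * N%:R.
Proof.
have mask f : sqnorm (fun u => (u != x)%:R * f u) <= sqnorm f.
  apply: ler_sum => u _; case: (u != x); first by rewrite mul1r.
  by rewrite mul0r expr0n sqr_ge0.
elim: t => [|t IH].
  rewrite expr0 expr1n mul1r (le_trans (mask (fun=> 1))) //.
  by rewrite /sqnorm sumr_const expr1n.
apply: le_trans (mask (ker_op (avoid x t))) _.
apply: le_trans (killed_contraction (x := x) _) _.
  by case: (t) => [|t'] /=; rewrite eqxx mul0r.
by rewrite (exprS _ t) exprMn -[leRHS]mulrA ler_wpM2l ?sqr_ge0.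
Qed.

(** After [s] free steps the value is the mean of [avoid x t] plus a mixing error. The mean is at
    most the root mean square, which decays at the killing rate; the factor [Num.sqrt N%:R] in the
    error is the price of passing from l2 to a pointwise bound. *)
Lemma avoid_le x s t u :
  avoid x (s + t) u <=
  (1 - delta / N%:R) ^+ t * (1 + rho ^+ s * Num.sqrt N%:R).
Proof.
have b0 := exprn_ge0 t killing_rate_ge0; have /andP[r0 _] := rho01.
have NR0 : 0 < N%:R :> R by rewrite ltr0n.
apply: le_trans (avoidD x s t u) _; apply: le_trans (iter_ker_op_le s _ u) _.
have sq := sqnorm_avoid x t.
rewrite mulrDr mulr1; apply: lerD.
  rewrite -(ler_pXn2r (_ : 0 < 2)%N) ?nnegrE //; last first.
    by rewrite divr_ge0 ?(ltW NR0) // sumr_ge0 // => v _; rewrite avoid_ge0.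
  rewrite -(ler_pM2r NR0); apply: le_trans sq; rewrite mulrC -subr_ge0.
  by rewrite -sqnorm_center sqnorm_ge0.
rewrite mulrCA ler_wpM2l ?exprn_ge0 //.
apply: le_trans (ler_wsqrtr sq) _.
by rewrite sqrtrM ?sqr_ge0 // sqrtr_sqr ger0_norm.
Qed.

(** The expected number of visits to [A] is its stationary share plus a geometric series of mixing
    errors. *)
Lemma sum_iter_indic_le (A : {set V}) T u :
  \sum_(s < T) iter s.+1 ker_op (indic A) u <=
  T%:R * (#|A|%:R / N%:R) + Num.sqrt #|A|%:R / (1 - rho).
Proof.
have /andP[r0 r1] := rho01; have r10 : 0 < 1 - rho by lra.
have mA : mean (indic A) = #|A|%:R / N%:R.
  rewrite /mean /indic; congr (_ / _).
  by rewrite -sum1_card natr_sum [RHS]big_mkcond; apply: eq_bigr => v _; case: ifP.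
apply: (@le_trans _ _ (\sum_(s < T) (#|A|%:R / N%:R + rho ^+ s * Num.sqrt #|A|%:R))).
  apply: ler_sum => s _; rewrite -mA; apply: le_trans (iter_ker_op_le _ _ _) _.
  rewrite sqnorm_indic lerD2l ler_wpM2r ?sqrtr_ge0 // exprS ler_piMl ?exprn_ge0 //.
  exact: ltW.
rewrite big_split /= sumr_const card_ord -[_ *+ T]mulr_natl lerD2l -mulr_suml.
rewrite [leRHS]mulrC ler_wpM2r ?sqrtr_ge0 //.
rewrite -[_^-1]mul1r ler_pdivlMr //.
have -> : (\sum_(i < T) rho ^+ i) * (1 - rho) = 1 - rho ^+ T.
  by rewrite mulrC -[1 - _]opprB mulNr -subrX1 opprB.
by rewrite gerBl exprn_ge0.
Qed.

(** Both parts of the expected visit count are at most [#|A| / 8]: the stationary part because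
    [8 T <= N], the mixing part because [#|A|] is large. The total is at most half of the
    [#|A| - b >= #|A| / 2] visits that are needed. *)
Lemma shrink_mean_half b T u (A : {set V}) :
  (8 * T <= N)%N -> (2 * b <= #|A|)%N -> (8 / (1 - rho)) ^+ 2 <= #|A|%:R ->
  T%:R / 2 <= shrink_mean b T u A.
Proof.
move=> TN bA MA; have /andP[r0 r1] := rho01; have r10 : 0 < 1 - rho by lra.
have c0 : 0 < 8 / (1 - rho) by rewrite divr_gt0.
have m0 : 0 < #|A|%:R :> R by apply: lt_le_trans MA; rewrite exprn_gt0.
have NR0 : 0 < N%:R :> R by rewrite ltr0n.
have ltbA : (b < #|A|)%N by move: m0; rewrite ltr0n; lia.
apply: le_trans (shrink_mean_ge u (leqnn T) ltbA (subxx _) (ltnW ltbA)).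
have x0 : 0 < #|A|%:R - b%:R :> R by rewrite subr_gt0 ltr_nat.
rewrite addrK mulrAC lerBrDr -lerBrDl ler_pdivrMr //.
have -> : T%:R - T%:R / 2 = T%:R / 2 :> R by lra.
rewrite -mulrA ler_wpM2l //; apply: le_trans (sum_iter_indic_le A T u) _.
have sA : Num.sqrt #|A|%:R / (1 - rho) <= #|A|%:R / 8.
  rewrite -[X in _ <= X / _](sqr_sqrtr (ltW m0)) expr2 -mulrA ler_wpM2l ?sqrtr_ge0 //.
  have : 8 / (1 - rho) <= Num.sqrt #|A|%:R.
    by rewrite -(ger0_norm (ltW c0)) -sqrtr_sqr ler_wsqrtr.
  lra.
have : T%:R * (#|A|%:R / N%:R) <= #|A|%:R / 8 :> R.
  rewrite mulrA ler_pdivrMr //.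
  have : 8 * T%:R <= N%:R :> R by rewrite -natrM ler_nat.
  nra.
have : 2 * b%:R <= #|A|%:R :> R by rewrite -natrM ler_nat.
lra.
Qed.

Lemma cover_mean_ge M T r u (U : {set V}) :
  (8 * T <= N)%N -> (8 / (1 - rho)) ^+ 2 <= M%:R -> (2 ^ r * M <= #|U|)%N ->
  r%:R * (T%:R / 2) <= cover_mean (r * T) u U.
Proof.
move=> TN MR; elim: r u U => [|r IH] u U MU.
  by rewrite mul0r mul0n /cover_mean big_ord0.
rewrite mulSn -natr1 mulrDl mul1r addrC.
(* One stage goes down to [2 ^ r * M] vertices and takes [T / 2] on average; the induction
   hypothesis covers the remaining [r] stages. *)
apply: le_trans (@cover_mean_shrink _ _ T _ IH u U _); last first.
  by apply: leq_trans MU; rewrite leq_mul2r leq_pexp2l ?orbT.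
rewrite lerD2r shrink_mean_half //; first by move: MU; rewrite expnS mulnA.
apply: (le_trans MR); rewrite ler_nat; apply: leq_trans MU.
by rewrite leq_pmull // expn_gt0.
Qed.

End kernel_operator.

(** * Expected cover times as sums over paths *)

Lemma big_tupleS (R : Type) (idx : R) (op : Monoid.com_law idx) (T : finType) t
    (F : t.+1.-tuple T -> R) :
  \big[op/idx]_(w : t.+1.-tuple T) F w =
  \big[op/idx]_x \big[op/idx]_(w : t.-tuple T) F (cons_tuple x w).
Proof.
rewrite pair_big /= (reindex (fun xw : T * t.-tuple T => cons_tuple xw.1 xw.2)) //.
exists (fun w : t.+1.-tuple T => (thead w, behead_tuple w)) => [[x w] _|w _] /=.
  by congr pair; apply/val_inj.
by rewrite [RHS](tuple_eta w); apply/val_inj.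
Qed.

Lemma big_ffun_ord1 (R : Type) (idx : R) (op : Monoid.com_law idx) (T : finType)
    (F : {ffun 'I_1 -> T} -> R) :
  \big[op/idx]_f F f = \big[op/idx]_x F [ffun=> x].
Proof.
rewrite (reindex (fun x : T => [ffun=> x] : {ffun 'I_1 -> T})) //.
exists (fun f : {ffun 'I_1 -> T} => f ord0) => [x _|f _]; first by rewrite ffunE.
by apply/ffunP => j; rewrite ffunE [j]ord1.
Qed.

Section path_sums.
Variables (R : realType) (n : nat) (G : graph n).
Implicit Types (i : 'I_n).

Lemma eq_path_prob i t (w w' : nat -> 'I_n) :
  (forall s, (s <= t)%N -> w s = w' s) -> path_prob R G i t w = path_prob R G i t w'.
Proof.
move=> e; rewrite /path_prob e //; congr (_ * _); apply: eq_bigr => s _.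
by rewrite !e //; apply: ltnW.
Qed.

Lemma path_prob_ge0 i t w : 0 <= path_prob R G i t w.
Proof. by rewrite mulr_ge0 // prodr_ge0 // => s _; rewrite divr_ge0. Qed.

Lemma path_probS i t (w : nat -> 'I_n) : path_prob R G i t.+1 w =
  (w 0%N == i)%:R * \sum_y step_prob R G i y * path_prob R G y t (fun s => w s.+1).
Proof.
rewrite /path_prob; have [<-|_] := eqVneq (w 0%N) i; last by rewrite !mul0r.
rewrite mul1r !mul1r big_ord_recl (bigD1 (w 1%N)) //= eqxx.
rewrite [X in _ = _ + X]big1 ?addr0 ?mul1r // => y ne.
by rewrite eq_sym (negbTE ne) mul0r mulr0.
Qed.

(** Links sums over trajectories with the one-step recursion. The recursion starts from [U :\ i]
    because the vertex occupied at time 0 counts as visited. *)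
Lemma sum_path_prob (phi : {set 'I_n} -> R) t i (U : {set 'I_n}) :
  \sum_(w : t.+1.-tuple 'I_n) path_prob R G i t (nth i w) * phi (U :\: [set x in w]) =
  unvisited_mean (step_prob R G) phi t i (U :\ i).
Proof.
elim: t i U => [|t IH] i U; rewrite big_tupleS (bigD1 i) //=.
  rewrite [X in _ + X]big1 ?addr0 => [|x ne]; last first.
    by rewrite big1 // => w _; rewrite /path_prob /= (negbTE ne) !mul0r.
  rewrite (big_pred1 [tuple]) => [|w]; last by apply/esym/eqP; exact: tuple0.
  rewrite /path_prob /= eqxx big_ord0 !mul1r; congr phi.
  by apply/setP => x; rewrite !inE.
rewrite [X in _ + X]big1 ?addr0 => [|x ne]; last first.
  by rewrite big1 // => w _; rewrite path_probS /= (negbTE ne) !mul0r.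
transitivity (\sum_(w : t.+1.-tuple 'I_n) \sum_y step_prob R G i y *
    (path_prob R G y t (nth y w) * phi (U :\ i :\: [set x in w]))).
  apply: eq_bigr => w _; rewrite path_probS /= eqxx mul1r mulr_suml.
  apply: eq_bigr => y _; rewrite -mulrA; congr (_ * (_ * phi _)).
    by apply: eq_path_prob => s st; apply: set_nth_default; rewrite size_tuple.
  by apply/setP => x; rewrite !inE negb_or; case: (x == i); rewrite ?andbF.
by rewrite exchange_big /=; apply: eq_bigr => y _; rewrite -IH mulr_sumr.
Qed.

End path_sums.

(** * The expected cover time as a series of tail probabilities *)

Section cover.
Variables (R : realType) (n : nat) (G : graph n) (k : nat) (i : 'I_n).
Variable W : walks R G k i.

Local Notation X := (@pos R n G k i W).

(** The joint trajectory up to time [t] takes finitely many values, so events about it are finite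
    unions of fibers whose probabilities [pos_law] provides. *)
Let path t (om : sample W) : {ffun 'I_k -> t.+1.-tuple 'I_n} :=
  [ffun j => [tuple X j s om | s < t.+1]].

Let nth_path t om j s : (s <= t)%N -> nth i (path t om j) s = X j s om.
Proof.
move=> st; rewrite ffunE -(tnth_nth i _ (Ordinal (st : (s < t.+1)%N))).
by rewrite tnth_mktuple.
Qed.

Let path_fiber t w :
  [set om | path t om = w]%classic =
  [set om | forall j s, (s <= t)%N -> X j s om = nth i (w j) s]%classic.
Proof.
apply/seteqP; split => om /=; first by move=> <- j s st; rewrite nth_path.
move=> e; apply/ffunP => j; apply: eq_from_tnth => s.
by rewrite ffunE tnth_mktuple e ?(tnth_nth i) // -ltnS.
Qed.

Let measurable_fiber t w : measurable [set om | path t om = w]%classic.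
Proof.
rewrite path_fiber (_ : [set _ | _]%classic =
  (\bigcap_(js in [set: 'I_k * 'I_t.+1])
     [set om | X js.1 js.2 om = nth i (w js.1) js.2])%classic).
  by apply: fin_bigcap_measurable => // js _; apply: measurable_pos.
apply/seteqP; split => om /= e; first by move=> [j s] _ /=; apply: e; rewrite -ltnS.
by move=> j s st; apply: (e (j, Ordinal (st : (s < t.+1)%N)) Logic.I).
Qed.

Let path_event t (Q : pred {ffun 'I_k -> t.+1.-tuple 'I_n}) :
  [set om | Q (path t om)]%classic =
  (\bigcup_(w in [set` Q]) [set om | path t om = w])%classic.
Proof.
by apply/seteqP; split => om /= => [q|[w /= q ->//]]; exists (path t om).
Qed.

Let measurable_path_event t (Q : pred {ffun 'I_k -> t.+1.-tuple 'I_n}) :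
  measurable [set om | Q (path t om)]%classic.
Proof. by rewrite path_event; apply: fin_bigcup_measurable. Qed.

Let Pr_path_event t (Q : pred {ffun 'I_k -> t.+1.-tuple 'I_n}) :
  Pr W [set om | Q (path t om)]%classic =
  (\sum_(w | Q w) \prod_j path_prob R G i t (nth i (w j)))%:E.
Proof.
rewrite path_event measure_fin_bigcup //; last first.
  apply/trivIsetP => w w' _ _ ne; apply/seteqP; split => om //= -[-> /eqP].
  by rewrite (negbTE ne).
rewrite -(@bigfs _ _ _ _ (index_enum _) Q) ?index_enum_uniq //; last first.
  by move=> w _; rewrite mem_index_enum.
rewrite -sumEFin; apply: eq_bigr => w _.
by rewrite path_fiber; exact: (@pos_law _ _ _ _ _ W t (fun j => nth i (w j))).
Qed.

Definition uncovered t : pred {ffun 'I_k -> t.+1.-tuple 'I_n} :=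
  fun w => [exists v, forall j, v \notin w j].

(** The probability that the cover time exceeds [t], as a finite sum free of the sample space. *)
Definition uncovered_prob t : R :=
  \sum_(w | @uncovered t w) \prod_j path_prob R G i t (nth i (w j)).

Lemma uncovered_prob_ge0 t : 0 <= uncovered_prob t.
Proof. by apply: sumr_ge0 => w _; apply: prodr_ge0 => j _; apply: path_prob_ge0. Qed.

Let uncoveredP t om : reflect
  (forall v, exists j s, (s <= t)%N /\ X j s om = v) (~~ uncovered (path t om)).
Proof.
apply: (iffP existsPn) => h v.
  have /forallPn[j] := h v; rewrite negbK ffunE => /tnthP[s ->].
  by exists j, s; rewrite tnth_mktuple -ltnS.
have [j [s [st <-]]] := h v; apply/forallPn; exists j; rewrite negbK -(nth_path _ _ st).
by rewrite mem_nth // size_tuple.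
Qed.

Let covered_homo om s t : (s <= t)%N ->
  ~~ uncovered (path s om) -> ~~ uncovered (path t om).
Proof.
move=> st /uncoveredP h; apply/uncoveredP => v; have [j [r [rs e]]] := h v.
by exists j, r; split=> //; apply: leq_trans st.
Qed.

(** A time is the number of instants strictly before it. If some vertex is never visited, the
    infimum is over the empty set and all terms are 1, so both sides are [+oo]. *)
Let cover_rv_series om : cover_rv om =
  (\sum_(0 <= t <oo) (uncovered (path t om))%:R%:E)%E.
Proof.
have s0 : forall t : nat, (0 <= t)%N -> true ->
    (0 <= (uncovered (path t om))%:R%:E :> \bar R)%E.
  by move=> t _ _; rewrite lee_fin.
apply/eqP; rewrite eq_le; apply/andP; split; last first.
  apply: lime_le; first exact: is_cvg_nneseries.
  apply: nearW => T; apply: le_ereal_inf_tmp => _ [t /= /uncoveredP ct <-].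
  rewrite sumEFin lee_fin -natr_sum ler_nat big_mkord.
  have [Tt|tT] := leqP T t.
    apply: leq_trans Tt; rewrite -[leqRHS]card_ord -sum1_card leq_sum // => s _.
    by case: uncovered.
  rewrite -(subnKC (ltnW tT)) big_split_ord /= [X in (_ + X)%N]big1 => [|s _].
    by rewrite addn0 -[leqRHS]card_ord -sum1_card leq_sum // => s _; case: uncovered.
  by rewrite (negbTE (covered_homo (leq_addr s t) ct)).
have ge T : (forall t, (t < T)%N -> uncovered (path t om)) ->
    (T%:R%:E <= \sum_(0 <= t <oo) (uncovered (path t om))%:R%:E :> \bar R)%E.
  move=> h; apply: le_trans (nneseries_lim_ge T s0).
  rewrite sumEFin lee_fin -natr_sum ler_nat big_mkord.
  rewrite -[leqLHS]card_ord -sum1_card leq_sum // => s _.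
  by rewrite h.
have [ct|nc] := pselect (exists t, ~~ uncovered (path t om)).
  have [t0 ct0 mint0] := ex_minnP ct.
  apply: (@le_trans _ _ t0%:R%:E).
    by apply: ereal_inf_lbound; exists t0 => //; apply/uncoveredP.
  by apply: ge => s st0; apply: contraTT st0 => /mint0; rewrite -leqNgt.
have -> : (\sum_(0 <= t <oo) (uncovered (path t om))%:R%:E = +oo :> \bar R)%E.
  apply/eqyP => A A0; apply: le_trans (ge (Num.bound A) _) => [|t _].
    by rewrite lee_fin ltW // archi_boundP // ltW.
  by apply: contrapT => /negP ct; apply: nc; exists t.
exact: leey.
Qed.

Lemma integral_cover_rv :
  (\int[Pr W]_om cover_rv om = \sum_(0 <= t <oo) (uncovered_prob t)%:E)%E.
Proof.
under eq_integral do rewrite cover_rv_series.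
have mE t : (fun om => (uncovered (path t om))%:R%:E : \bar R) =
   (fun om => (\1_([set om | uncovered (path t om)]%classic) om)%:E).
  apply/funext => om; rewrite indicE.
  have [h|h] := boolP (uncovered (path t om)); first by rewrite mem_set.
  by rewrite memNset //; apply/negP.
rewrite integral_nneseries //; last first.
  move=> t; rewrite mE; apply/measurable_EFinP; apply: measurable_indic.
  exact: (measurable_path_event (@uncovered t)).
apply: eq_eseriesr => t _; rewrite mE integral_indic //.
by rewrite setIT; exact: Pr_path_event.
Qed.

Lemma uncovered_prob_le1 t : uncovered_prob t <= 1.
Proof.
rewrite -lee_fin -(Pr_path_event (@uncovered t)); apply: probability_le1.
exact: (measurable_path_event (@uncovered t)).
Qed.

(** Union bound over the missed vertex; by independence, the probability that all walks miss it is a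
    [k]-th power. *)
Lemma uncovered_prob_le t : uncovered_prob t <=
  \sum_v avoid (step_prob R G) v t i ^+ k.
Proof.
have st0 u v : 0 <= step_prob R G u v by rewrite divr_ge0.
have avE v : \sum_(w : t.+1.-tuple 'I_n | v \notin w) path_prob R G i t (nth i w) <=
    avoid (step_prob R G) v t i.
  apply: (@le_trans _ _ (unvisited_mean (step_prob R G) (fun A => (v \in A)%:R) t i
      ([set: 'I_n]%SET :\ i))); last first.
    rewrite unvisited_mean_mem ?finset.setD11 // ler_piMl ?lern1 ?leq_b1 //.
    exact: avoid_ge0.
  rewrite -sum_path_prob big_mkcond /=; apply: ler_sum => w _.
  by rewrite !inE andbT; case: ifP => _; rewrite ?mulr1 ?mulr0.
have av0 v : 0 <= \sum_(w : t.+1.-tuple 'I_n | v \notin w) path_prob R G i t (nth i w).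
  by apply: sumr_ge0 => w _; apply: path_prob_ge0.
apply: (@le_trans _ _ (\sum_v \prod_(j < k)
   \sum_(w : t.+1.-tuple 'I_n) (v \notin w)%:R * path_prob R G i t (nth i w))).
  (* The product of [k] sums over trajectories becomes one sum over families of [k] trajectories. *)
  under [leRHS]eq_bigr do rewrite bigA_distr_bigA.
  rewrite exchange_big /= /uncovered_prob big_mkcond; apply: ler_sum => w _ /=.
  have p0 (v : 'I_n) : 0 <=
      \prod_(j < k) ((v \notin w j)%:R * path_prob R G i t (nth i (w j))).
    by apply: prodr_ge0 => j _; rewrite mulr_ge0 ?path_prob_ge0.
  case: ifP => [/existsP[v /forallP h]|_]; last by apply: sumr_ge0.
  have -> : \prod_j path_prob R G i t (nth i (w j)) =
      \prod_(j < k) ((v \notin w j)%:R * path_prob R G i t (nth i (w j))).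
    by apply: eq_bigr => j _; rewrite h mul1r.
  by rewrite [leRHS](bigD1 v) //= lerDl sumr_ge0.
apply: ler_sum => v _; rewrite prodr_const card_ord.
have eE : \sum_(w : t.+1.-tuple 'I_n) (v \notin w)%:R * path_prob R G i t (nth i w) =
    \sum_(w : t.+1.-tuple 'I_n | v \notin w) path_prob R G i t (nth i w).
  rewrite [RHS]big_mkcond; apply: eq_bigr => w _.
  by case: ifP => _; rewrite ?mul1r ?mul0r.
by rewrite eE lerXn2r ?nnegrE ?avoid_ge0.
Qed.

End cover.

Lemma uncovered_prob1 (R : realType) n (G : graph n) i t :
  uncovered_prob R G 1 i t =
  unvisited_mean (step_prob R G) (fun A => (A != finset.set0)%:R) t i (~: [set i])%SET.
Proof.
have -> : (~: [set i] = [set: 'I_n] :\ i)%SET by apply/setP => x; rewrite !inE andbT.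
rewrite -sum_path_prob /uncovered_prob big_mkcond big_ffun_ord1.
apply: eq_bigr => w _; rewrite big_ord1 !ffunE.
have -> : uncovered ([ffun=> w] : {ffun 'I_1 -> _}) =
    ([set: 'I_n] :\: [set x in w] != finset.set0)%SET.
  apply/existsP/set0Pn => -[v].
    by move=> /forallP/(_ ord0); rewrite ffunE => h; exists v; rewrite !inE h.
  by rewrite !inE andbT => h; exists v; apply/forallP => j; rewrite ffunE.
by case: ifP => _; rewrite ?mulr1 ?mulr0.
Qed.

(** * The speed-up *)

Lemma nat_between (R : realType) (x : R) : 0 <= x ->
  exists m : nat, x <= m%:R <= x + 1.
Proof.
move=> x0; have /andP[t1 t2] := Num.Theory.truncn_itv x0.
by exists (Num.truncn x).+1; rewrite ltW //= -natr1 lerD2r.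
Qed.

(** * The step kernel and its contraction for complete graphs and expanders *)

Section step_kernel.
Variables (R : realType) (n : nat) (G : graph n).

Lemma step_prob_ge0 u v : 0 <= step_prob R G u v.
Proof. by rewrite divr_ge0. Qed.

Lemma sum_step_prob u : \sum_v step_prob R G u v = 1.
Proof.
rewrite /step_prob -mulr_suml -natr_sum.
have -> : (\sum_v (v \in moves G u) = #|moves G u|)%N.
  by rewrite -sum1_card [RHS]big_mkcond; apply: eq_bigr => v _; case: ifP.
rewrite divff // pnatr_eq0 -lt0n /moves.
by case: ifPn => [_|]; rewrite ?cards1 // -card_gt0.
Qed.

Lemma regular_step_prob d u v : (0 < d)%N -> regular G d ->
  step_prob R G u v = (G u v)%:R / d%:R.
Proof.
move=> d0 reg; rewrite /step_prob /moves ifN ?reg ?inE //.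
by rewrite -card_gt0 reg.
Qed.

Lemma regular_step_prob_sym d u v : (0 < d)%N -> regular G d ->
  step_prob R G u v = step_prob R G v u.
Proof. by move=> d0 reg; rewrite !(regular_step_prob _ _ d0 reg) adj_sym. Qed.

End step_kernel.

(** On mean-zero functions the sum over all [v != u] is [- f u], so the kernel acts as
    multiplication by [- 1 / (n - 1)]. *)
Lemma complete_contraction (R : realType) n : (3 <= n)%N ->
  (forall u v, step_prob R (complete n) u v = step_prob R (complete n) v u) /\
  l2_contraction (step_prob R (complete n)) (1 / 2).
Proof.
move=> n3; have reg : regular (complete n) n.-1.
  move=> u; have := cardsC1 u; rewrite card_ord => <-.
  by apply: eq_card => v; rewrite !inE eq_sym.
have n1 : (0 < n.-1)%N by lia.
split=> [u v|f f0]; first exact: regular_step_prob_sym n1 reg.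
have -> : sqnorm (ker_op (step_prob R (complete n)) f) =
    (n.-1%:R ^-1) ^+ 2 * sqnorm f.
  rewrite /sqnorm mulr_sumr; apply: eq_bigr => u _; rewrite -exprMn -sqrrN.
  congr (_ ^+ 2); rewrite /ker_op mulrC.
  under eq_bigr do rewrite (regular_step_prob _ _ _ n1 reg) mulrAC.
  rewrite -mulr_suml -mulNr; congr (_ / _); apply/eqP; rewrite eqr_oppLR; apply/eqP.
  move: f0; rewrite (bigD1 u) //= addrC => /eqP; rewrite addr_eq0 => /eqP <-.
  rewrite [RHS]big_mkcond /=; apply: eq_bigr => v _.
  by rewrite eq_sym; case: eqP => _; rewrite ?mul1r ?mul0r.
rewrite ler_wpM2r ?sqnorm_ge0 // lerXn2r ?nnegrE ?invr_ge0 //.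
by rewrite mul1r lef_pV2 ?posrE ?ltr0n // ler_nat; lia.
Qed.

(** The spectral gap is applied to the all-ones vector, an eigenvector for [d] whose orthogonal
    complement consists of the mean-zero functions. *)
Lemma ndlambda_contraction (R : realType) n (G : graph n) d (lambda : R) :
  (2 <= n)%N -> lambda < d%:R -> ndlambda_graph G d lambda ->
  [/\ 0 <= lambda / d%:R < 1,
      forall u v, step_prob R G u v = step_prob R G v u &
      l2_contraction (step_prob R G) (lambda / d%:R)].
Proof.
move=> n2 ltd [reg Hl].
have A_sym : (adjmx R G)^T = adjmx R G.
  by apply/matrixP => u v; rewrite !mxE adj_sym.
have mulA (f : 'rV[R]_n) u : (f *m adjmx R G) 0 u = \sum_v (G u v)%:R * f 0 v.
  by rewrite mxE; apply: eq_bigr => v _; rewrite mxE adj_sym mulrC.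
have one_ne : const_mx 1 != 0 :> 'rV[R]_n.
  apply/rV0Pn; exists (Ordinal (ltnW n2)); by rewrite mxE oner_neq0.
have oneA : const_mx 1 *m adjmx R G = d%:R *: (const_mx 1 : 'rV[R]_n).
  apply/rowP => u; rewrite mulA !mxE mulr1 -(reg u) -sum1_card natr_sum [RHS]big_mkcond.
  by apply: eq_bigr => v _; rewrite !mxE inE mulr1; case: (G u v).
have [l0 gap] := symmetric_spectral_gap A_sym n2 one_ne oneA ltd Hl.
have dR : 0 < d%:R :> R by exact: le_lt_trans ltd.
have d0 : (0 < d)%N by rewrite -(ltr0n R).
split=> [|u v|f f0]; first by rewrite divr_ge0 ?(ltW dR) //= ltr_pdivrMr ?mul1r.
- exact: regular_step_prob_sym d0 reg.
- have /gap : (\row_u f u) *m (const_mx 1 : 'rV[R]_n)^T = 0.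
    apply/matrixP => a b; rewrite !mxE -[RHS]f0.
    by apply: eq_bigr => u _; rewrite !mxE mulr1.
  have -> : \sum_i (\row_u f u) 0 i ^+ 2 = sqnorm f.
    by apply: eq_bigr => u _; rewrite mxE.
  have -> : \sum_u ((\row_u f u) *m adjmx R G) 0 u ^+ 2 =
      sqnorm (ker_op (step_prob R G) f) * d%:R ^+ 2.
    rewrite /sqnorm mulr_suml; apply: eq_bigr => u _; rewrite mulA -exprMn.
    congr (_ ^+ 2); rewrite /ker_op mulr_suml; apply: eq_bigr => v _.
    rewrite (regular_step_prob _ _ _ d0 reg) mxE mulrAC divfK ?gt_eqF //.
  by move=> h; rewrite expr_div_n [leRHS]mulrAC ler_pdivlMr // exprn_gt0.
Qed.

(** * Cover time bounds of order [n * ln n / k] and [n * ln n], and their quotient *)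

Section linear_speedup.
Variables (R : realType) (rho : R).
Hypothesis rho01 : 0 <= rho < 1.

Let delta : R := (1 - rho ^+ 2) / 4.
Let e1 : R := expR 1.

Let delta_gt0 : 0 < delta.
Proof. by have /andP[r0 r1] := rho01; rewrite /delta; nra. Qed.

Let e1_ge2 : 2 <= e1.
Proof. by have := expR_ge1Dx (1 : R); rewrite -/e1; lra. Qed.

(** One summand for each contribution to the upper bound: mixing time, two roundings up, decay to
    [1 / n], geometric tail. *)
Let K : R := 2 / (1 - rho) + 2 + delta^-1 + e1 * (1 + delta^-1).

Let K_gt0 : 0 < K.
Proof.
have /andP[r0 r1] := rho01; have := e1_ge2.
have : 0 < 2 / (1 - rho) by rewrite divr_gt0 // subr_gt0.
have : 0 < delta^-1 by rewrite invr_gt0.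
by rewrite /K; nra.
Qed.

Section graph_bounds.
Variables (n : nat) (G : graph n).
Hypothesis sym : forall u v, step_prob R G u v = step_prob R G v u.
Hypothesis contr : l2_contraction (step_prob R G) rho.
Hypothesis n_large : e1 <= n%:R.

Let L : R := ln n%:R.

Let n_gt0 : 0 < n%:R :> R.
Proof. by have := e1_ge2; have := n_large; lra. Qed.

Let L_ge1 : 1 <= L.
Proof.
by rewrite /L -[leLHS](expRK (1 : R)) ler_ln ?posrE ?expR_gt0.
Qed.

Let expL : expR L = n%:R.
Proof. by rewrite /L lnK ?posrE. Qed.

Let avoid_exp k (v i : 'I_n) s t : (k <= n)%N -> 2 * L / (1 - rho) <= s%:R ->
  avoid (step_prob R G) v (s + t) i ^+ k <=
  e1 * (expR (- (delta / n%:R * k%:R))) ^+ t.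
Proof.
move=> kn hs; have /andP[r0 r1] := rho01.
have r10 : 0 < 1 - rho by lra.
have cardV : #|'I_n| = n by rewrite card_ord.
have N0 : (0 < #|'I_n|)%N by rewrite cardV -(ltr0n R).
have av := avoid_le (@step_prob_ge0 R n G) (@sum_step_prob R n G) sym rho01 contr
  N0 v s t i.
have kr := killing_rate_ge0 rho01 N0.
rewrite cardV -/delta in av kr.
have b_exp : 1 - delta / n%:R <= expR (- (delta / n%:R)).
  by have := expR_ge1Dx (- (delta / n%:R)).
(* From [rho <= expR (rho - 1)], the choice of [s] gives [rho ^+ s <= n ^- 2], while the square root
   is at most [n]. *)
have rs : rho ^+ s * Num.sqrt n%:R <= n%:R^-1.
  have h1 : rho ^+ s <= expR (- (2 * L)).
    have h : rho <= expR (rho - 1) by have := expR_ge1Dx (rho - 1); lra.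
    apply: le_trans (_ : expR (rho - 1) ^+ s <= _).
      by rewrite lerXn2r ?nnegrE ?expR_ge0.
    rewrite -expRM_natl ler_expR.
    by move: hs; rewrite ler_pdivrMr //; nra.
  have h2 : Num.sqrt n%:R <= n%:R :> R.
    rewrite -[leRHS]ger0_norm ?ler0n // -sqrtr_sqr ler_wsqrtr //.
    have : 1 <= n%:R :> R by have := e1_ge2; have := n_large; lra.
    nra.
  apply: le_trans (ler_pM _ _ h1 h2) _; rewrite ?exprn_ge0 ?sqrtr_ge0 //.
  rewrite -expL -expRN -expRD ler_expR; lra.
have av0 : 0 <= avoid (step_prob R G) v (s + t) i.
  exact: avoid_ge0 (@step_prob_ge0 R n G) _ _ _.
apply: le_trans (_ : (expR (- (delta / n%:R)) ^+ t * expR (n%:R^-1)) ^+ k <= _).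
  rewrite lerXn2r ?nnegrE ?mulr_ge0 ?exprn_ge0 ?expR_ge0 //.
  apply: le_trans av _; apply: ler_pM.
  - exact: exprn_ge0.
  - by rewrite addr_ge0 // mulr_ge0 ?exprn_ge0 ?sqrtr_ge0.
  - by rewrite lerXn2r ?nnegrE ?expR_ge0.
  - by apply: le_trans (expR_ge1Dx _); rewrite lerD2l.
rewrite exprMn -!expRM_natl -!expRD ler_expR.
(* Here [k <= n] keeps the [k]-th power of the mixing factor [1 + 1 / n] below [e1]. *)
have : k%:R * n%:R^-1 <= 1 :> R.
  by rewrite ler_pdivrMr // mul1r ler_nat.
lra.
Qed.

(** The time [m] consists of [s] mixing steps and [t0] further steps, with [t0] at least
    [n L / (delta k)]; the latter bring the decay factor down to [1 / n], which pays for the [n]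
    terms of the union bound. *)
Let uncovered_le k (i : 'I_n) : (0 < k <= n)%N -> exists m : nat,
  m%:R <= 2 * L / (1 - rho) + 1 + (n%:R * L / (delta * k%:R) + 1) /\
  forall t, uncovered_prob R G k i (m + t) <=
    e1 * (expR (- (delta / n%:R * k%:R))) ^+ t.
Proof.
move=> /andP[k0 kn]; have /andP[r0 r1] := rho01.
have r10 : 0 < 1 - rho by lra.
have kR : 0 < k%:R :> R by rewrite ltr0n.
have L0 : 0 <= L by have := L_ge1; lra.
have [|s /andP[s1 s2]] := @nat_between R (2 * L / (1 - rho)).
  by rewrite divr_ge0 ?mulr_ge0 // ltW.
have [|t0 /andP[t1 t2]] := @nat_between R (n%:R * L / (delta * k%:R)).
  by apply: divr_ge0; apply: mulr_ge0; rewrite // ltW.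
exists (s + t0)%N; split; first by rewrite natrD lerD.
move=> t; rewrite -addnA; apply: le_trans (uncovered_prob_le _ _ _ _ _) _.
apply: le_trans (ler_sum _ (fun v _ => avoid_exp v i (t0 + t) kn s1)) _.
rewrite sumr_const card_ord -[leLHS]mulr_natl [leLHS]mulrCA ler_wpM2l ?expR_ge0 //.
rewrite exprD mulrA ler_piMl ?exprn_ge0 ?expR_ge0 //.
rewrite -expRM_natl -{1}expL -expRD -[leRHS]expR0 ler_expR.
have dk0 : 0 < delta * k%:R by apply: mulr_gt0.
move: t1; rewrite ler_pdivrMr // => t1.
rewrite -(ler_pM2l n_gt0) mulr0 mulrDr.
suff -> : n%:R * (t0%:R * - (delta / n%:R * k%:R)) = - (t0%:R * (delta * k%:R)) by lra.
by field; rewrite gt_eqF.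
Qed.

Lemma cover_time_from_le k (i : 'I_n) : (0 < k <= n)%N ->
  (cover_time_from R G k i <= (K * (n%:R * L / k%:R))%:E)%E.
Proof.
move=> kn; rewrite /cover_time_from integral_cover_rv.
have [m [mK tail]] := uncovered_le i kn.
have /andP[k0 kn'] := kn; have /andP[r0 r1] := rho01.
have kR : 0 < k%:R :> R by rewrite ltr0n.
set q := expR _ in tail.
pose y := delta / n%:R * k%:R.
have y0 : 0 < y by rewrite mulr_gt0 // divr_gt0.
(* Since [q] is the exponential of [- y], it is at most [1 / (1 + y)]. *)
have q1 : (1 - q)^-1 <= 1 + y^-1.
  have h : q * (1 + y) <= 1.
    by rewrite /q -/y expRN mulrC ler_pdivrMr ?expR_gt0 // mul1r expR_ge1Dx.
  have y1 : 0 < 1 + y by lra.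
  have e : 1 + y^-1 = (1 - (1 + y)^-1)^-1.
    have -> : 1 - (1 + y)^-1 = y / (1 + y) by field; rewrite gt_eqF.
    by rewrite invf_div mulrDl mul1r divff ?gt_eqF // addrC.
  have y2 : 1 / (1 + y) < 1 by rewrite ltr_pdivrMr //; lra.
  rewrite e lef_pV2 ?posrE; [|rewrite subr_gt0|by rewrite subr_gt0 -div1r].
    by rewrite lerD2l lerN2 -div1r ler_pdivlMr.
  by apply: le_lt_trans y2; rewrite ler_pdivlMr.
have q01 : 0 < 1 - q by rewrite subr_gt0 /q -/y -expR0 ltr_expR; lra.
(* The first [m] terms are probabilities, hence at most 1 each; the others are dominated by a
   geometric series of ratio [q]. *)
have part T : \sum_(0 <= t < T) uncovered_prob R G k i t <= K * (n%:R * L / k%:R).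
  apply: (@le_trans _ _ (\sum_(0 <= t < m + T) uncovered_prob R G k i t)).
    rewrite [leRHS](big_cat_nat (n := T)) ?leq_addl //= lerDl.
    by apply: sumr_ge0 => t _; apply: uncovered_prob_ge0.
  rewrite big_mkord big_split_ord /=.
  (* The last bracket, a sum of nonnegative terms, is the slack in K. *)
  have -> : K * (n%:R * L / k%:R) =
      (2 * L / (1 - rho) + 1 + (n%:R * L / (delta * k%:R) + 1)) +
      e1 * (1 + y^-1) +
      ((n%:R * L / k%:R - L) * (2 / (1 - rho)) + (n%:R * L / k%:R - 1) * 2 +
       e1 * ((n%:R * L / k%:R - 1) + delta^-1 * (n%:R / k%:R) * (L - 1))).
    by rewrite /K /y; field; rewrite !gt_eqF ?subr_gt0.
  have nk1 : 1 <= n%:R / k%:R :> R by rewrite ler_pdivlMr // mul1r ler_nat.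
  have D1 : L <= n%:R * L / k%:R by rewrite mulrAC ler_peMl //; have := L_ge1; lra.
  rewrite -[leLHS]addr0; apply: lerD; last first.
    have := L_ge1; have e0 := e1_ge2; move=> L1; repeat apply: addr_ge0.
    - by rewrite mulr_ge0 ?subr_ge0 // divr_ge0 // subr_ge0 ltW.
    - by rewrite mulr_ge0 // subr_ge0; lra.
    - rewrite mulr_ge0 ?expR_ge0 // addr_ge0 //; first by rewrite subr_ge0; lra.
      by rewrite mulr_ge0 ?subr_ge0 // mulr_ge0 ?invr_ge0 ?ltW // (lt_le_trans _ nk1).
  apply: lerD.
    apply: le_trans mK; rewrite -[leRHS]/(m%:R).
    rewrite -[X in X%:R]card_ord -sum1_card natr_sum.
    by apply: ler_sum => t _; apply: uncovered_prob_le1 (independent_walks R G k i) _.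
  apply: (@le_trans _ _ (\sum_(t < T) e1 * q ^+ t)).
    by apply: ler_sum => t _; apply: tail.
  rewrite -mulr_sumr ler_wpM2l ?expR_ge0 //; apply: le_trans q1.
  rewrite -[_^-1]mul1r ler_pdivlMr // mulrC -[1 - q]opprB mulNr -subrX1 opprB gerBl.
  by rewrite exprn_ge0 ?expR_ge0.
apply: lime_le.
  by apply: is_cvg_nneseries => t _ _; rewrite lee_fin uncovered_prob_ge0.
by apply: nearW => T; rewrite sumEFin lee_fin.
Qed.

Lemma cover_mean_le_cover_time (i : 'I_n) T :
  ((cover_mean (step_prob R G) T i (~: [set i])%SET)%:E <= cover_time_from R G 1 i)%E.
Proof.
rewrite /cover_time_from integral_cover_rv.
apply: le_trans (nneseries_lim_ge T _); last first.
  by move=> t _ _; rewrite lee_fin uncovered_prob_ge0.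
rewrite sumEFin lee_fin big_mkord /cover_mean.
by apply: ler_sum => t _; rewrite uncovered_prob1.
Qed.

(** Keeps the denominator of the speed-up positive: at time 0 only [i] has been visited, so the
    first term of the series is at least 1. *)
Lemma cover_time_from_ge1 k (i : 'I_n) : (1 < n)%N -> (1 <= cover_time_from R G k i)%E.
Proof.
move=> n1; rewrite /cover_time_from integral_cover_rv.
apply: le_trans (nneseries_lim_ge 1 _); last first.
  by move=> t _ _; rewrite lee_fin uncovered_prob_ge0.
rewrite big_nat1 lee_fin /uncovered_prob.
have [v vi] : exists v, v != i.
  have : (0 < #|~: [set i]%SET|)%N by rewrite cardsC1 card_ord; lia.
  by case/card_gt0P => v; rewrite !inE; exists v.
rewrite (bigD1 [ffun=> [tuple i]]) /=; last first.
  by apply/existsP; exists v; apply/forallP => j; rewrite ffunE inE.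
rewrite [X in X + _]big1 => [|j _]; last first.
  by rewrite ffunE /path_prob /= eqxx big_ord0 mulr1.
rewrite lerDl; apply: sumr_ge0 => w _; apply: prodr_ge0 => j _.
exact: path_prob_ge0.
Qed.

(** There are [r >= L / 2] halvings from the [n - 1] initially unvisited vertices down to [M], each
    of mean at least [T / 2] with [T = n %/ 8 >= n / 16]. *)
Lemma cover_time_ge M : (8 / (1 - rho)) ^+ 2 <= M%:R -> (0 < M)%N ->
  (16 <= n)%N -> (16 * M ^ 2 <= n)%N -> forall i : 'I_n,
  ((n%:R * L / 64)%:E <= cover_time_from R G 1 i)%E.
Proof.
move=> hM M0 n16 nM i.
pose r := trunc_log 2 (n.-1 %/ M).
have r1 : (2 ^ r * M <= n.-1)%N.
  rewrite -leq_divRL //; apply: trunc_logP => //; rewrite divn_gt0 //.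
  by move: nM; rewrite expnS expn1; nia.
have r2 : (n <= 2 ^ r.+1 * M)%N.
  have : (n.-1 %/ M < 2 ^ r.+1)%N by apply: trunc_log_ltn.
  rewrite ltn_divLR //; lia.
(* Squaring [r2] gives [n ^ 2 <= 4 * 4 ^ r * M ^ 2], and [16 * M ^ 2 <= n] absorbs the factor
   [M ^ 2]. *)
have r3 : (n <= 4 ^ r)%N.
  have e : (4 ^ r = 2 ^ r * 2 ^ r)%N by rewrite -expnMn.
  rewrite e; move: r2 nM; rewrite !expnS expn0 muln1.
  set a := (2 ^ r)%N => h1 h2.
  have : (16 * (M * M) * n <= (2 * a * M) * (2 * a * M))%N.
    by apply: leq_trans (leq_mul h1 h1); rewrite leq_mul2r h2 orbT.
  have M2 : (0 < M * M)%N by rewrite muln_gt0 M0.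
  have -> : (2 * a * M * (2 * a * M) = (M * M) * (4 * (a * a)))%N by ring.
  have -> : (16 * (M * M) * n = (M * M) * (16 * n))%N by ring.
  rewrite leq_pmul2l //; lia.
have Lr : L <= 2 * r%:R.
  have ln2 : ln 2 <= 1 :> R.
    by have := @le_ln1Dx R 1; rewrite -[1 + 1]/(2%:R); apply; lra.
  have -> : 2 * r%:R = (2 *+ r : R) by rewrite mulr_natr.
  apply: (@le_trans _ _ (ln (4 ^+ r))).
    by rewrite ler_ln ?posrE ?exprn_gt0 // -natrX ler_nat.
  rewrite lnXn // ler_wMn2r //.
  have -> : 4 = 2 ^+ 2 :> R by rewrite -natrX.
  rewrite lnXn // mulr2n; lra.
apply: le_trans (cover_mean_le_cover_time i (r * (n %/ 8))); rewrite lee_fin.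
have N0 : (0 < #|'I_n|)%N by rewrite card_ord; lia.
apply: le_trans (cover_mean_ge (@step_prob_ge0 R n G) (@sum_step_prob R n G) sym rho01
  contr N0 (M := M) i _ hM _); last first.
- by rewrite cardsC1 card_ord.
- by rewrite card_ord mulnC leq_trunc_div.
have : n%:R <= 16 * (n %/ 8)%:R :> R by rewrite -natrM ler_nat; lia.
have := L_ge1; move: (n %/ 8)%:R => T L1 hT.
have : 0 <= (16 * T - n%:R) * L by rewrite mulr_ge0 ?subr_ge0 //; lra.
have : 0 <= (2 * r%:R - L) * T by rewrite mulr_ge0 ?subr_ge0 //; have := n_gt0; lra.
nra.
Qed.

End graph_bounds.

Lemma speedup_linear : exists c : R, 0 < c /\ exists N : nat,
  forall n (G : graph n), (N <= n)%N ->
  (forall u v, step_prob R G u v = step_prob R G v u) ->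
  l2_contraction (step_prob R G) rho ->
  forall k, (1 <= k <= n)%N -> c * k%:R <= speedup R G k.
Proof.
have [|M /andP[hM _]] := @nat_between R ((8 / (1 - rho)) ^+ 2).
  exact: sqr_ge0.
have M0 : (0 < M)%N.
  rewrite -(ltr0n R); apply: lt_le_trans hM; rewrite exprn_gt0 // divr_gt0 //.
  by rewrite subr_gt0; case/andP: rho01.
(* The quotient of the lower bound [n L / 64] by the upper bound [K n L / k]. *)
exists (64 * K)^-1; split; first by rewrite invr_gt0 mulr_gt0.
exists (Num.bound e1 + (16 + 16 * M ^ 2))%N => n G nN sym contr k k1n.
have n_large : e1 <= n%:R.
  rewrite (le_trans (ltW (archi_boundP (expR_ge0 1)))) // ler_nat.
  exact: leq_trans (leq_addr _ _) nN.
have n16 : (16 <= n)%N by lia.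
have nM : (16 * M ^ 2 <= n)%N by lia.
have n0 : (0 < n)%N by lia.
pose L : R := ln n%:R.
have nL0 : 0 < n%:R * L.
  rewrite mulr_gt0 ?ltr0n // ln_gt0 // ltr1n; lia.
have le_cov j : (1 <= j <= n)%N ->
    (cover_time R G j <= (K * (n%:R * L / j%:R))%:E)%E.
  move=> jn; apply: bigmax_le => [|i _]; first exact: leNye.
  exact: cover_time_from_le.
have ge_cov j (B : \bar R) : (forall i, B <= cover_time_from R G j i)%E ->
    (B <= cover_time R G j)%E.
  by move=> h; apply: le_trans (h (Ordinal n0)) _; apply: le_bigmax.
have ge1 : ((n%:R * L / 64)%:E <= cover_time R G 1)%E.
  by apply: ge_cov => i; apply: cover_time_ge hM M0 n16 nM i.
have gek : (1 <= cover_time R G k)%E.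
  by apply: ge_cov => i; apply: cover_time_from_ge1; lia.
rewrite /speedup.
(* The two-sided bounds exclude infinite cover times, so [fine] returns the true values. *)
have := le_cov 1%N n0; move: ge1; case: (cover_time R G 1) => [C1| |] //=.
rewrite !lee_fin => ge1 _.
have := le_cov k k1n; move: gek; case: (cover_time R G k) => [Ck| |] //=.
rewrite !lee_fin => gek lek.
have /andP[k0 _] := k1n; have kR : 0 < k%:R :> R by rewrite ltr0n.
rewrite ler_pdivlMr; last by lra.
apply: le_trans ge1; rewrite [_^-1 * _]mulrC mulrAC ler_pdivrMr ?mulr_gt0 //.
have -> : n%:R * L / 64 * (64 * K) = K * (n%:R * L / k%:R) * k%:R.
  by field; rewrite gt_eqF.
by rewrite mulrC ler_wpM2r // ltW.
Qed.

End linear_speedup.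

Theorem theorem3 (R : realType) :
  (exists c : R, 0 < c /\ exists N : nat, forall n : nat, (N <= n)%N ->
     forall k : nat, (1 <= k <= n)%N ->
     c * k%:R <= speedup R (complete n) k) /\
  (forall (d : nat) (lambda : R), lambda < d%:R ->
   exists c : R, 0 < c /\ exists N : nat, forall n : nat, (N <= n)%N ->
     forall G : graph n, ndlambda_graph G d lambda ->
     forall k : nat, (1 <= k <= n)%N ->
     c * k%:R <= speedup R G k).
Proof.
split=> [|d lambda ltd].
  have half : 0 <= (1 / 2 : R) < 1 by lra.
  have [c [c0 [N HN]]] := speedup_linear half.
  exists c; split=> //; exists (N + 3)%N => n nN k kn.
  have [|sym contr] := @complete_contraction R n; first by lia.
  by apply: HN => //; lia.
have [rho01|nrho] := boolP (0 <= lambda / d%:R < 1).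
  have [c [c0 [N HN]]] := speedup_linear rho01.
  exists c; split=> //; exists (N + 2)%N => n nN G nG k kn.
  have [|_ sym contr] := ndlambda_contraction _ ltd nG; first by lia.
  by apply: HN => //; lia.
(* No graph on two or more vertices satisfies the hypothesis in this case. *)
exists 1; split=> //; exists 2 => n n2 G nG.
by have [rho01] := ndlambda_contraction n2 ltd nG; rewrite rho01 in nrho.
Qed.
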